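(* Assume the vector variational inequality defined by $F$ and $K$ is monotone and $K$ is polyhedral convex (an intersection of finitely many closed half-spaces of $\mathbb{R}^n$). (a) If the Pareto solution set $\mathrm{Sol}(F,K)$ is disconnected, then each connected component of $\mathrm{Sol}(F,K)$ is unbounded. (b) If $\mathrm{Sol}(F,K)$ is bounded and nonempty, then it is connected.
   Context: Let $K\subset\mathbb{R}^n$ be a nonempty closed convex set and $F_1,\dots,F_m:K\to\mathbb{R}^n$ continuous functions; write $F=(F_1,\dots,F_m)$ and $F(x)(u)=(\langle F_1(x),u\rangle,\dots,\langle F_m(x),u\rangle)$. The problem is monotone if each $F_l$ is monotone on $K$: $\langle F_l(y)-F_l(x),y-x\rangle\ge0$ for all $x,y\in K$. The Pareto solution set $\mathrm{Sol}(F,K)$ is the set of $x\in K$ such that $F(x)(x-y)\notin\mathbb{R}^m_+\setminus\{0\}$ for all $y\in K$. *)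

(* Defs.v *)
From mathcomp Require Import ssreflect ssrfun ssrbool eqtype ssrnat seq fintype bigop.
From Stdlib Require Import Reals.
Open Scope R_scope.

Definition vec (n : nat) := 'I_n -> R.

Definition vsub {n} (x y : vec n) : vec n := fun i => x i - y i.

Definition dot {n} (x y : vec n) : R := \big[Rplus/R0]_(i < n) (x i * y i).

Definition vnorm {n} (x : vec n) : R := sqrt (dot x x).
Definition vdist {n} (x y : vec n) : R := vnorm (vsub x y).

Definition vset n := vec n -> Prop.

Definition vopen {n} (U : vset n) : Prop :=
  forall x, U x -> exists eps, 0 < eps /\ forall y, vdist x y < eps -> U y.

Definition vclosed {n} (S : vset n) : Prop := vopen (fun x => ~ S x).

Definition vconvex {n} (S : vset n) : Prop :=
  forall x y t, S x -> S y -> 0 <= t <= 1 ->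
    S (fun i => t * x i + (1 - t) * y i).

Definition vpolyhedral {n} (K : vset n) : Prop :=
  exists (p : nat) (a : 'I_p -> vec n) (b : 'I_p -> R),
    forall x, K x <-> (forall j, dot (a j) x <= b j).

Definition vbounded {n} (S : vset n) : Prop :=
  exists M, forall x, S x -> vnorm x <= M.

Definition vconnected {n} (S : vset n) : Prop :=
  ~ (exists U V : vset n, vopen U /\ vopen V /\
       (forall x, S x -> U x \/ V x) /\
       (exists x, S x /\ U x) /\ (exists x, S x /\ V x) /\
       (forall x, S x -> U x -> V x -> False)).

Definition vcomponent {n} (S : vset n) (x : vec n) : vset n :=
  fun y => exists C : vset n, (forall z, C z -> S z) /\ vconnected C /\ C x /\ C y.

Definition continuous_on {n} (K : vset n) (G : vec n -> vec n) : Prop :=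
  forall x eps, K x -> 0 < eps -> exists delta, 0 < delta /\
    forall y, K y -> vdist x y < delta -> vdist (G x) (G y) < eps.

Definition monotone_on {n} (K : vset n) (G : vec n -> vec n) : Prop :=
  forall x y, K x -> K y -> 0 <= dot (vsub (G y) (G x)) (vsub y x).

(* Pareto solution set Sol(F,K): x in K such that for all y in K,
   F(x)(x-y) = (<F_l(x), x-y>)_l does not lie in R^m_+ \ {0}. *)
Definition Sol {n m} (F : 'I_m -> vec n -> vec n) (K : vset n) : vset n :=
  fun x => K x /\ forall y, K y ->
    ~ ((forall l, 0 <= dot (F l x) (vsub x y)) /\
       (exists l, dot (F l x) (vsub x y) <> 0)).

(* Main.v *)
Require Import Defs.
From HB Require Import structures.
From mathcomp Require Import ssreflect ssrfun ssrbool eqtype ssrnat seq fintype bigop.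
From Stdlib Require Import Reals Lra Classical FunctionalExtensionality.
Open Scope R_scope.

(** Since [K] is polyhedral, Farkas' lemma shows that the Pareto solutions are exactly the solutions of the scalar variational inequalities with positive weights, and by Minty's lemma each scalar solution set is convex. Join the weights of a solution [x] with bounded component to the weights of another solution by a segment. The scalar solution sets along the segment have a closed graph, and a nonempty bounded one stays nonempty and bounded under small changes of the weights, because monotonicity makes the inequality solvable on the intersection of [K] with a ball. So the set of parameters whose solution set is nonempty and lies in the component of [x] is open and closed, hence everything, and the component of [x] is the whole Pareto set. *)

(** * Finite sums of reals *)

Lemma RplusA : associative Rplus. Proof. by move=> x y z; ring. Qed.
Lemma RplusC : commutative Rplus. Proof. by move=> x y; ring. Qed.
Lemma Rplus0 : left_id R0 Rplus. Proof. by move=> x; ring. Qed.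
HB.instance Definition _ := Monoid.isComLaw.Build R R0 Rplus RplusA RplusC Rplus0.

Lemma Rsum_scal (T : Type) (s : seq T) (P : pred T) (c : R) (f : T -> R) :
  \big[Rplus/R0]_(i <- s | P i) (c * f i) = c * \big[Rplus/R0]_(i <- s | P i) f i.
Proof.
by elim/big_rec2: _ => [|i x y _ ->]; ring.
Qed.

Lemma Rsum_le (T : Type) (s : seq T) (P : pred T) (f g : T -> R) :
  (forall i, f i <= g i) ->
  \big[Rplus/R0]_(i <- s | P i) f i <= \big[Rplus/R0]_(i <- s | P i) g i.
Proof.
move=> fg; elim/big_rec2: _ => [|i x y _ h]; first lra.
by have := fg i; lra.
Qed.

Lemma Rsum_ge0 (T : Type) (s : seq T) (P : pred T) (f : T -> R) :
  (forall i, 0 <= f i) -> 0 <= \big[Rplus/R0]_(i <- s | P i) f i.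
Proof.
move=> f0; elim/big_rec: _ => [|i x _ h]; first lra.
by have := f0 i; lra.
Qed.

Lemma Rsum_gt0 (T : finType) (f : T -> R) (j : T) :
  (forall i, 0 <= f i) -> 0 < f j -> 0 < \big[Rplus/R0]_i f i.
Proof.
move=> f0 fj; rewrite (bigD1 j) //=.
have := @Rsum_ge0 _ (index_enum T) (fun i => i != j) f f0; lra.
Qed.

Lemma Rsum_lin (T : Type) (s : seq T) (P : pred T) (a b : R) (f g : T -> R) :
  \big[Rplus/R0]_(i <- s | P i) (a * f i + b * g i) =
  a * \big[Rplus/R0]_(i <- s | P i) f i + b * \big[Rplus/R0]_(i <- s | P i) g i.
Proof. by rewrite big_split /= !Rsum_scal. Qed.

(** * Euclidean geometry: Cauchy-Schwarz, segments, balls *)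

Definition vlin {n} (a : R) (x : vec n) (b : R) (y : vec n) : vec n :=
  fun i => a * x i + b * y i.

Section Euclid.
Variable n : nat.
Implicit Types x y z : vec n.

Lemma dotC x y : dot x y = dot y x.
Proof. by apply: eq_bigr => i _; ring. Qed.

Lemma dot_linl a x b y z : dot (vlin a x b y) z = a * dot x z + b * dot y z.
Proof.
rewrite /dot -Rsum_lin; apply: eq_bigr => i _.
by rewrite /vlin; ring.
Qed.

Lemma dot_linr a x b y z : dot z (vlin a x b y) = a * dot z x + b * dot z y.
Proof. by rewrite dotC dot_linl !(dotC z). Qed.

Lemma vsubE x y : vsub x y = vlin 1 x (-1) y.
Proof. by apply: functional_extensionality => i; rewrite /vsub /vlin; ring. Qed.

Lemma dot_subl x y z : dot (vsub x y) z = dot x z - dot y z.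
Proof. by rewrite vsubE dot_linl; ring. Qed.

Lemma dot_subr x y z : dot z (vsub x y) = dot z x - dot z y.
Proof. by rewrite vsubE dot_linr; ring. Qed.

Lemma dot_ge0 x : 0 <= dot x x.
Proof. by apply: Rsum_ge0 => i; nra. Qed.

Lemma vnorm_ge0 x : 0 <= vnorm x.
Proof. exact: sqrt_pos. Qed.

Lemma vnorm_sqr x : vnorm x * vnorm x = dot x x.
Proof. exact/sqrt_sqrt/dot_ge0. Qed.

Lemma vnorm_le x r : 0 <= r -> dot x x <= r * r -> vnorm x <= r.
Proof. by have := vnorm_sqr x; have := vnorm_ge0 x; nra. Qed.

Lemma vnorm_lt x r : 0 <= r -> dot x x < r * r -> vnorm x < r.
Proof. by have := vnorm_sqr x; have := vnorm_ge0 x; nra. Qed.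

Lemma cauchy_schwarz x y : Rabs (dot x y) <= vnorm x * vnorm y.
Proof.
have sq : dot x y * dot x y <= dot x x * dot y y.
  have h t : 0 <= dot x x - 2 * t * dot x y + t * t * dot y y.
    have := dot_ge0 (vlin 1 x (- t) y).
    by rewrite !dot_linl !dot_linr (dotC y x); nra.
  have y0 := dot_ge0 y; have x0 := dot_ge0 x.
  case: (Req_dec (dot y y) 0) => [e|ne]; last first.
    (* This [t] minimises the quadratic [h]. *)
    have := h (dot x y / dot y y).
    have -> : dot x x - 2 * (dot x y / dot y y) * dot x y
       + dot x y / dot y y * (dot x y / dot y y) * dot y y
       = (dot x x * dot y y - dot x y * dot x y) / dot y y by field.
    have yp : 0 < dot y y by lra.
    move=> /(Rmult_le_compat_r _ _ _ y0).
    by rewrite Rmult_0_l /Rdiv Rmult_assoc Rinv_l //; lra.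
  rewrite e.
  case: (Req_dec (dot x y) 0) => [-> | xy]; first lra.
  (* With [dot y y = 0] the quadratic is affine in [t], and this [t] gives it the value -1. *)
  have := h ((dot x x + 1) / (2 * dot x y)); rewrite e.
  have -> : 2 * ((dot x x + 1) / (2 * dot x y)) * dot x y = dot x x + 1 by field.
  by lra.
have := vnorm_ge0 x; have := vnorm_ge0 y; move=> y0 x0.
apply: Rsqr_incr_0_var; last by nra.
rewrite -Rsqr_abs /Rsqr.
have -> : vnorm x * vnorm y * (vnorm x * vnorm y)
  = (vnorm x * vnorm x) * (vnorm y * vnorm y) by ring.
by rewrite !vnorm_sqr.
Qed.

Lemma vdistC x y : vdist x y = vdist y x.
Proof. by rewrite /vdist /vnorm !dot_subl !dot_subr; congr sqrt; ring. Qed.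

Lemma vnorm_triangle x y : vnorm x <= vnorm y + vdist x y.
Proof.
have y0 := vnorm_ge0 y; have d0 := vnorm_ge0 (vsub x y).
apply: vnorm_le; first by rewrite /vdist; lra.
have := vnorm_sqr (vsub x y); rewrite -/(vdist x y) => e.
have := vnorm_sqr y => e'.
have := cauchy_schwarz y (vsub x y); rewrite -/(vdist x y).
have := Rle_abs (dot y (vsub x y)).
move: e; rewrite !dot_subl !dot_subr (dotC y x) => e.
by nra.
Qed.

Lemma vdist_lin x y s t :
  vdist (vlin s x (1 - s) y) (vlin t x (1 - t) y) = Rabs (s - t) * vdist x y.
Proof.
rewrite /vdist /vnorm -sqrt_Rsqr_abs -sqrt_mult; last exact: dot_ge0.
  by congr sqrt; rewrite !dot_subl !dot_subr !dot_linl !dot_linr /Rsqr; ring.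
exact: Rle_0_sqr.
Qed.

Lemma vdist_lin_start x y t : 0 <= t -> vdist x (vlin t y (1 - t) x) = t * vdist y x.
Proof.
move=> t0; have {1}-> : x = vlin 0 y (1 - 0) x.
  by apply: functional_extensionality => i; rewrite /vlin; ring.
by rewrite vdist_lin Rabs_minus_sym Rminus_0_r Rabs_pos_eq.
Qed.

Lemma coord_le_vnorm x i : Rabs (x i) <= vnorm x.
Proof.
apply: Rsqr_incr_0_var; last exact: vnorm_ge0.
rewrite -Rsqr_abs /Rsqr vnorm_sqr /dot (bigD1 i) //=.
rewrite -{1}(Rplus_0_r (x i * x i)); apply: Rplus_le_compat_l.
by apply: Rsum_ge0 => j; nra.
Qed.

Lemma vnorm_lt_coord x eps :
  0 < eps -> (forall i, Rabs (x i) < eps / (INR n + 1)) -> vnorm x < eps.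
Proof.
move=> e0 h; set r := eps / (INR n + 1) in h.
have n0 := pos_INR n.
have r0 : 0 < r by apply: Rdiv_lt_0_compat; lra.
have re : r * (INR n + 1) = eps by rewrite /r; field; lra.
apply: vnorm_lt; first lra.
apply: (@Rle_lt_trans _ (\big[Rplus/R0]_(i < n) (r * r))).
  apply: Rsum_le => i; have := h i => /Rabs_def2 hi; nra.
have -> : \big[Rplus/R0]_(i < n) (r * r) = INR n * (r * r).
  rewrite big_const_ord; elim: (n) => [|k IH]; first by rewrite /=; ring.
  by rewrite iterS IH S_INR; ring.
nra.
Qed.

Lemma ball_convex r : vconvex (fun x : vec n => vnorm x <= r).
Proof.
move=> x y t hx hy ht; change (vnorm (vlin t x (1 - t) y) <= r).
have x0 := vnorm_ge0 x; have y0 := vnorm_ge0 y.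
apply: vnorm_le; first lra.
have : dot (vlin t x (1 - t) y) (vlin t x (1 - t) y)
  = t * dot x x + (1 - t) * dot y y - t * (1 - t) * dot (vsub x y) (vsub x y).
  by rewrite !dot_subl !dot_subr !dot_linl !dot_linr (dotC y x); ring.
rewrite -!vnorm_sqr => ->.
have := vnorm_sqr (vsub x y); have := dot_ge0 (vsub x y) => d0 ->.
have hd : 0 <= t * (1 - t) * dot (vsub x y) (vsub x y).
  by apply: Rmult_le_pos => //; nra.
have : vnorm x * vnorm x <= r * r by nra.
have : vnorm y * vnorm y <= r * r by nra.
move=> h1 h2; nra.
Qed.

Lemma vclosedP (S : vset n) x : vclosed S ->
  (forall eps, 0 < eps -> exists y, S y /\ vdist x y < eps) -> S x.
Proof.
move=> cS h; apply: NNPP => /cS [e [e0 he]].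
by have [y [Sy xy]] := h e e0; case: (he y xy).
Qed.

(** Intermediate value theorem for the squared norm, a polynomial along the segment. It serves to
    pull a far solution back to a prescribed sphere. *)
Lemma norm_between x z r : vnorm x <= r -> r <= vnorm z ->
  exists t, 0 <= t <= 1 /\ vnorm (vlin t z (1 - t) x) = r.
Proof.
move=> hx hz; have x0 := vnorm_ge0 x.
pose f t := dot (vlin t z (1 - t) x) (vlin t z (1 - t) x) - r * r.
have fE t : f t = t * t * dot z z + 2 * (t * (1 - t)) * dot x z
                  + (1 - t) * (1 - t) * dot x x - r * r.
  by rewrite /f !dot_linl !dot_linr (dotC z x); ring.
have cf : continuity f.
  have -> : f = fun t => t * t * dot z z + 2 * (t * (1 - t)) * dot x z
                  + (1 - t) * (1 - t) * dot x x - r * r.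
    exact: functional_extensionality.
  by reg.
have [t [ht ft]] : { t | 0 <= t <= 1 /\ f t = 0 }.
  apply: IVT_cor => //; first lra.
  have z0 := vnorm_ge0 z.
  have f0 : f 0 <= 0 by rewrite fE -!vnorm_sqr; nra.
  have f1 : 0 <= f 1 by rewrite fE -!vnorm_sqr; nra.
  nra.
exists t; split=> //.
have := vnorm_sqr (vlin t z (1 - t) x); rewrite /f in ft.
have := vnorm_ge0 (vlin t z (1 - t) x); nra.
Qed.

End Euclid.

(** Connectedness of the unit interval, by the supremum [c] of the initial intervals on which [P]
    holds: local constancy gives [P c] and pushes past [c] unless [c = 1]. *)
Lemma locally_constant_unit (P : R -> Prop) :
  (forall t, 0 <= t <= 1 -> exists d, 0 < d /\
     forall s, 0 <= s <= 1 -> Rabs (s - t) < d -> (P s <-> P t)) ->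
  P 0 -> P 1.
Proof.
move=> lc P0.
pose E u := 0 <= u <= 1 /\ forall w, 0 <= w <= u -> P w.
have E0 : E 0.
  by split=> [|w hw]; [lra | have -> : w = 0 by lra].
have [c [cub club]] : { c | is_lub E c }.
  apply: completeness; last by exists 0.
  by exists 1 => u [hu _]; lra.
have c0 := cub 0 E0.
have c1 : c <= 1 by apply: club => u [hu _]; lra.
have [d [d0 hd]] := lc c (conj c0 c1).
have [u [Eu uc]] : exists u, E u /\ c - d < u.
  apply: NNPP => h; have : c <= c - d; last by lra.
  by apply: club => u Eu; case: (Rle_lt_dec u (c - d)) => // lt; case: h; exists u.
have uc' := cub u Eu; case: Eu => hu Pu.
have Pc : P c by apply/(hd u) => //; [apply: Rabs_def1; lra | apply: Pu; lra].
have Em : E (Rmin 1 (c + d / 2)).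
  have [m1 m2] := (Rmin_l 1 (c + d / 2), Rmin_r 1 (c + d / 2)).
  split=> [|w hw]; first by split=> //; apply: Rmin_glb; lra.
  case: (Rle_lt_dec w u) => wu; first by apply: Pu; lra.
  by apply/(hd w) => //; [lra | apply: Rabs_def1; lra].
have := cub _ Em; case: Em => _; rewrite /Rmin.
by case: (Rle_dec 1 (c + d / 2)) => // h Pm; [move=> _; apply: Pm; lra | lra].
Qed.

Lemma locally_constant (J P : R -> Prop) a b :
  (forall u v w, J u -> J v -> 0 <= w <= 1 -> J (u + w * (v - u))) ->
  (forall t, J t -> exists d, 0 < d /\
     forall s, J s -> Rabs (s - t) < d -> (P s <-> P t)) ->
  J a -> J b -> P a -> P b.
Proof.
move=> cJ lc Ja Jb Pa.
have -> : b = a + 1 * (b - a) by ring.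
apply: (locally_constant_unit (fun w => P (a + w * (b - a)))); last first.
  by have -> : a + 0 * (b - a) = a by ring.
move=> t ht; have [d [d0 hd]] := lc _ (cJ _ _ _ Ja Jb ht).
have k0 : 0 < Rabs (b - a) + 1 by have := Rabs_pos (b - a); lra.
exists (d / (Rabs (b - a) + 1)); split; first exact: Rdiv_lt_0_compat.
move=> s hs st; apply: hd; first exact: cJ.
have -> : a + s * (b - a) - (a + t * (b - a)) = (s - t) * (b - a) by ring.
rewrite Rabs_mult.
have := Rabs_pos (s - t); have := Rabs_pos (b - a).
have : d / (Rabs (b - a) + 1) * (Rabs (b - a) + 1) = d by field; lra.
nra.
Qed.

(** * Cluster points of bounded directed families *)

Section Compactness.
Variable n : nat.

(** Directed families of nonempty sets are filter bases; they play the part of sequences, and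
    cluster points then come from suprema instead of subsequences. *)
Definition directed (I : Type) (B : I -> vset n) : Prop :=
  forall i j, exists k, forall x, B k x -> B i x /\ B j x.

(** The cluster value is the limit superior of the [k]-th coordinate along the filter base, the
    supremum of [E]. *)
Lemma coordinate_cluster (I : Type) (i0 : I) (B : I -> vset n) (r : R) (k : 'I_n) :
  directed I B -> (forall i, exists x, B i x) ->
  (forall i x, B i x -> vnorm x <= r) ->
  exists c, forall i eps, 0 < eps -> exists x, B i x /\ Rabs (x k - c) < eps.
Proof.
move=> dB neB bB.
pose E u := forall i, exists x, B i x /\ u <= x k.
have bk i x : B i x -> - r <= x k <= r.
  move=> /bB h; have := coord_le_vnorm _ x k => h'.
  have [h1 h2] := (Rle_abs (x k), Rle_abs (- x k)).
  by rewrite Rabs_Ropp in h2; lra.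
have [c [cub club]] : { c | is_lub E c }.
  apply: completeness.
    by exists r => u /(_ i0) [x [/bk hx ux]]; lra.
  by exists (- r) => i; have [x Bx] := neB i; exists x; split=> //; case: (bk _ _ Bx).
exists c => i eps e0.
have [u [Eu uc]] : exists u, E u /\ c - eps < u.
  apply: NNPP => h; have : c <= c - eps; last by lra.
  by apply: club => u Eu; case: (Rle_lt_dec u (c - eps)) => // lt; case: h; exists u.
(* Otherwise every set of the family has a point with coordinate at least [c + eps], so [c + eps]
   belongs to [E]. *)
have [j hj] : exists j, forall x, B j x -> x k < c + eps.
  apply: NNPP => h; have : c + eps <= c; last by lra.
  apply: cub => j; apply: NNPP => h'; apply: h; exists j => x Bx.
  by case: (Rlt_le_dec (x k) (c + eps)) => // le; case: h'; exists x.
have [l hl] := dB i j; have [x [/hl [Bi Bj] ux]] := Eu l.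
by exists x; split=> //; have := hj _ Bj; move=> ?; apply: Rabs_def1; lra.
Qed.

Lemma cluster_point (I : Type) (i0 : I) (B : I -> vset n) (r : R) :
  directed I B -> (forall i, exists x, B i x) ->
  (forall i x, B i x -> vnorm x <= r) ->
  exists c : vec n, forall i eps, 0 < eps -> exists x, B i x /\ vdist c x < eps.
Proof.
move=> dB neB bB.
(* Bolzano-Weierstrass by treating the coordinates one at a time. *)
suff h (s : seq 'I_n) : exists c : vec n, forall i eps, 0 < eps ->
    exists x, B i x /\ forall k, k \in s -> Rabs (x k - c k) < eps.
  have [c hc] := h (enum 'I_n); exists c => i eps e0.
  have p : 0 < eps / (INR n + 1).
    by apply: Rdiv_lt_0_compat => //; have := pos_INR n; lra.
  have [x [Bx hx]] := hc i _ p; exists x; split=> //.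
  rewrite vdistC; apply: vnorm_lt_coord => // k.
  by apply: hx; rewrite mem_enum.
elim: s => [|k s [c hc]].
  exists (fun=> 0) => i eps _; have [x Bx] := neB i.
  by exists x; split.
(* The refined family also demands closeness to the coordinates already found; the precision joins
   the index, so it is again directed. *)
pose B' (j : I * posreal) : vset n := fun x =>
  B j.1 x /\ forall l, l \in s -> Rabs (x l - c l) < j.2.
have one : 0 < 1 by lra.
have [||| ck hck] := coordinate_cluster _ (i0, mkposreal 1 one) B' r k.
- move=> [i e] [j f]; have [l hl] := dB i j.
  have m0 : 0 < Rmin e f by apply: Rmin_glb_lt; [case: (e) | case: (f)].
  exists (l, mkposreal _ m0) => x [/hl [Bi Bj]] /= hx.
  have [h1 h2] := (Rmin_l e f, Rmin_r e f).
  by split; split=> // l' /hx /=; lra.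
- by move=> [i [e e0]]; exact: hc.
- by move=> [i e] x [/bB].
exists (fun l => if l == k then ck else c l) => i eps e0.
have [x [[Bx hx] xk]] := hck (i, mkposreal eps e0) eps e0.
exists x; split=> // l; rewrite inE; case: eqP => [-> _ //|_ /=].
exact: hx.
Qed.

End Compactness.

(** * Connected sets and components *)

Section Connectedness.
Variable n : nat.
Implicit Types S D U V : vset n.

(** Along a segment from a point of [U] to a point of [V], membership in [U] is locally constant. *)
Lemma convex_connected S : vconvex S -> vconnected S.
Proof.
move=> cS [U [V [oU [oV [cov [[x [Sx Ux]] [[y [Sy Vy]] dis]]]]]]].
pose g t := vlin t y (1 - t) x.
have Sg t : 0 <= t <= 1 -> S (g t) by move=> ht; exact: cS.
have near W t : vopen W -> W (g t) ->
    exists d, 0 < d /\ forall s, Rabs (s - t) < d -> W (g s).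
  move=> oW /oW [e [e0 he]].
  have k0 : 0 < vdist y x + 1 by have := vnorm_ge0 _ (vsub y x); rewrite -/(vdist _ _); lra.
  exists (e / (vdist y x + 1)); split; first exact: Rdiv_lt_0_compat.
  move=> s st; apply: he; rewrite vdist_lin Rabs_minus_sym.
  have := Rabs_pos (s - t).
  have : e / (vdist y x + 1) * (vdist y x + 1) = e by field; lra.
  nra.
suff : U (g 1).
  have -> : g 1 = y by apply: functional_extensionality => i; rewrite /g /vlin; ring.
  by move=> Uy; exact: (dis y).
apply: (locally_constant_unit (fun t => U (g t))); last first.
  by have -> : g 0 = x by apply: functional_extensionality => i; rewrite /g /vlin; ring.
move=> t ht; case: (cov _ (Sg _ ht)) => Wt.
  have [d [d0 hd]] := near U t oU Wt; exists d; split=> // s _ /hd Us.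
  by split.
have [d [d0 hd]] := near V t oV Wt; exists d; split=> // s hs /hd Vs.
by split=> Us; [case: (dis (g s)) => //; exact: Sg | case: (dis (g t)) => //; exact: Sg].
Qed.

(** Whichever open set contains [x], the connected set joining [x] to a point of the other one would
    be separated. *)
Lemma star_connected S x :
  (forall y, S y -> exists D, (forall z, D z -> S z) /\ vconnected D /\ D x /\ D y) ->
  vconnected S.
Proof.
move=> h [U [V [oU [oV [cov [[u [Su Uu]] [[v [Sv Vv]] dis]]]]]]].
have [D [DS [cD [Dx Du]]]] := h u Su; have [E [ES [cE [Ex Ev]]]] := h v Sv.
case: (cov x (DS _ Dx)) => Wx.
  case: cE; exists U, V; split=> //; split=> //; split=> [z /ES /cov //|].
  split; first by exists x.
  by split=> [|z /ES]; [exists v | exact: dis].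
case: cD; exists U, V; split=> //; split=> //; split=> [z /DS /cov //|].
split; first by exists u.
by split=> [|z /DS]; [exists x | exact: dis].
Qed.

(** An open set that contains the limit [x] already meets [D], so a separation of the enlarged set
    separates [D]. This makes components relatively closed. *)
Lemma add_limit_connected D x : vconnected D ->
  (forall eps, 0 < eps -> exists y, D y /\ vdist x y < eps) ->
  vconnected (fun y => D y \/ y = x).
Proof.
move=> cD lim [U [V [oU [oV [cov [[u [Su Uu]] [[v [Sv Vv]] dis]]]]]]].
have meet W : vopen W -> forall y, (D y \/ y = x) -> W y -> exists z, D z /\ W z.
  move=> oW y [Dy Wy|-> Wx]; first by exists y.
  have [e [e0 he]] := oW x Wx; have [z [Dz xz]] := lim e e0.
  by exists z; split=> //; exact: he.
apply: cD; exists U, V; split=> //; split=> //; split=> [z Dz|]; first by apply: cov; left.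
split; first exact: meet Su Uu.
split; first exact: meet Sv Vv.
by move=> z Dz; apply: dis; left.
Qed.

Lemma component_sub S x y : vcomponent S x y -> S y.
Proof. by case=> D [DS [_ [_ Dy]]]; exact: DS. Qed.

Lemma component_connected S x : vconnected (vcomponent S x).
Proof.
apply: (star_connected _ x) => y [D [DS [cD [Dx Dy]]]].
exists D; split=> [z Dz|//]; by exists D.
Qed.

(** The union of the component and [D] is connected, because both are connected and contain [z]. *)
Lemma component_maximal S x D z : vconnected D -> (forall y, D y -> S y) ->
  vcomponent S x z -> D z -> forall y, D y -> vcomponent S x y.
Proof.
move=> cD DS Cz Dz y Dy.
exists (fun w => vcomponent S x w \/ D w); split; first by move=> w [/component_sub //|/DS].
have Cx : vcomponent S x x.
  case: (Cz) => E [ES [cE [Ex _]]]; by exists E.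
split; last by split; [left | right].
apply: (star_connected _ z) => w [Cw|Dw].
  exists (vcomponent S x); split; first by left.
  by split; first exact: component_connected.
by exists D; split; first by right.
Qed.

Lemma component_self S x : S x -> vcomponent S x x.
Proof.
move=> Sx; exists (eq^~ x); split; first by move=> z ->.
split=> //; apply: convex_connected => y z t -> -> _.
by apply: functional_extensionality => i; ring.
Qed.

End Connectedness.

(** * Theorems of the alternative *)

Section Farkas.
Variable n : nat.

(* Bartl's induction: a separator [v] of the remaining vectors with [<f j0, v> > 0] is used to project along [f j0]. *)
Lemma farkas_seq (T : eqType) (s : seq T) : uniq s ->
  forall (f : T -> vec n) (c : vec n),
  (exists l : T -> R, (forall j, 0 <= l j) /\
     forall i, c i = \big[Rplus/R0]_(j <- s) (l j * f j i)) \/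
  (exists v, (forall j, j \in s -> dot (f j) v <= 0) /\ 0 < dot c v).
Proof.
elim: s => [|j0 s IH] /=.
  move=> _ f c; case: (classic (exists i, c i <> 0)) => [[i ci]|nc].
    right; exists c; split=> //.
    by apply: (Rsum_gt0 _ _ i) => [k|]; nra.
  left; exists (fun=> 0); split=> [j|i]; first lra.
  by rewrite big_nil; apply: NNPP => h; case: nc; exists i.
move=> /andP [j0s us] f c; have {}IH := IH us.
(* As [j0] does not occur in [s], overriding the multiplier at [j0] leaves the sum over [s]
   unchanged. *)
have ext (l : T -> R) mu i :
    \big[Rplus/R0]_(j <- j0 :: s) ((if j == j0 then mu else l j) * f j i)
    = mu * f j0 i + \big[Rplus/R0]_(j <- s) (l j * f j i).
  rewrite big_cons eqxx; congr (_ + _).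
  apply: eq_big_seq => j js; case: eqP => // e; by rewrite -e js in j0s.
case: (IH f c) => [[l [l0 hl]]|[v [hv cv]]].
  left; exists (fun j => if j == j0 then 0 else l j); split.
    by move=> j; case: ifP => _ //; lra.
  by move=> i; rewrite ext hl; ring.
case: (Rle_lt_dec (dot (f j0) v) 0) => fv.
  by right; exists v; split=> // j; rewrite inE => /orP [/eqP -> //|/hv].
(* Normalised separator, with [dot (f j0) w = 1]. *)
pose w := vlin (/ dot (f j0) v) v 0 v.
have wE z : dot z w = / dot (f j0) v * dot z v by rewrite /w dot_linr; ring.
have i0 : 0 < / dot (f j0) v by exact: Rinv_0_lt_compat.
have fw : dot (f j0) w = 1 by rewrite wE; field; lra.
have cw : 0 < dot c w by rewrite wE; nra.
have hw j : j \in s -> dot (f j) w <= 0 by move=> /hv; rewrite wE; nra.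
clearbody w; case: (IH (fun j => vlin 1 (f j) (- dot (f j) w) (f j0)) (vlin 1 c (- dot c w) (f j0))).
  move=> [l [l0 hl]].
  (* Expanding the projected identity, [mu] is the coefficient that [f j0] receives; it is
     nonnegative since [dot (f j) w <= 0] on [s]. *)
  pose mu := dot c w + \big[Rplus/R0]_(j <- s) (l j * - dot (f j) w).
  left; exists (fun j => if j == j0 then mu else l j); split.
    move=> j; case: ifP => _ //.
    suff : 0 <= \big[Rplus/R0]_(j <- s) (l j * - dot (f j) w) by rewrite /mu; lra.
    rewrite big_seq; elim/big_rec: _ => [|k x /hw hk h]; first lra.
    by have := l0 k; nra.
  move=> i; rewrite ext.
  have := hl i; rewrite {1}/vlin.
  have -> : \big[Rplus/R0]_(j <- s) (l j * vlin 1 (f j) (- dot (f j) w) (f j0) i)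
    = 1 * \big[Rplus/R0]_(j <- s) (l j * f j i)
      + f j0 i * \big[Rplus/R0]_(j <- s) (l j * - dot (f j) w).
    by rewrite -Rsum_lin; apply: eq_bigr => j _; rewrite /vlin; ring.
  rewrite /mu => e; lra.
move=> [u [hu cu]].
(* This vector is orthogonal to [f j0], and its products with [f j] and [c] are those of [u] with
   the projected vectors. *)
right; exists (vlin 1 u (- dot (f j0) u) w); split; last first.
  by move: cu; rewrite dot_linl dot_linr; lra.
move=> j; rewrite inE => /orP [/eqP ->|/hu]; rewrite !dot_linr ?dot_linl; first by rewrite fw; lra.
lra.
Qed.

Lemma farkas (T : finType) (f : T -> vec n) (c : vec n) :
  (exists l : T -> R, (forall j, 0 <= l j) /\
     forall i, c i = \big[Rplus/R0]_j (l j * f j i)) \/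
  (exists v, (forall j, dot (f j) v <= 0) /\ 0 < dot c v).
Proof.
case: (farkas_seq _ _ (index_enum_uniq T) f c) => [h|[v [hv cv]]]; [by left|right].
by exists v; split=> // j; apply: hv; exact: mem_index_enum.
Qed.

End Farkas.

(** Farkas in dimension [p + 1], with the columns of [M] extended by a leading 1, slack vectors
    [-e_k], and target [(1, 0)]. The leading coordinate normalises the weights; in the other
    alternative its separator entry is positive and makes the inequalities strict. *)
Lemma ville (p : nat) (M : 'I_p -> 'I_p -> R) :
  (exists l : 'I_p -> R, (forall j, 0 <= l j) /\ \big[Rplus/R0]_j l j = 1 /\
     forall i, 0 <= \big[Rplus/R0]_j (l j * M i j)) \/
  (exists u : 'I_p -> R, (forall i, 0 <= u i) /\
     forall j, \big[Rplus/R0]_i (M i j * u i) < 0).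
Proof.
pose ext (a : R) (w : 'I_p -> R) : vec p.+1 :=
  fun i => if unlift ord0 i is Some k then w k else a.
have ext0 a w : ext a w ord0 = a by rewrite /ext unlift_none.
have extS a w k : ext a w (lift ord0 k) = w k by rewrite /ext liftK.
have dotE a w v : dot (ext a w) v =
    a * v ord0 + \big[Rplus/R0]_(k < p) (w k * v (lift ord0 k)).
  rewrite /dot big_ord_recl ext0; congr (_ + _).
  by apply: eq_bigr => k _; rewrite extS.
pose f (j : 'I_p + 'I_p) : vec p.+1 := match j with
  | inl j => ext 1 (fun i => M i j)
  | inr k => ext 0 (fun i => if i == k then -1 else 0) end.
have delta (k : 'I_p) (g : 'I_p -> R) :
    \big[Rplus/R0]_(i < p) ((if i == k then -1 else 0) * g i) = - g k.
  rewrite (bigD1 k) //= eqxx big1 => [|i /negbTE ->]; last ring.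
  by rewrite -[R0]/0; ring.
case: (farkas _ _ f (ext 1 (fun=> 0))) => [[l [l0 hl]]|[v [hv cv]]].
  left; exists (fun j => l (inl j)); split; first by move=> j.
  split.
    have := hl ord0; rewrite ext0 big_sumType /= => ->.
    rewrite [X in _ + X]big1 => [|k _]; last by rewrite ext0; ring.
    rewrite -[R0]/0 Rplus_0_r; apply: eq_bigr => j _; rewrite ext0; ring.
  move=> i; have := hl (lift ord0 i); rewrite extS big_sumType /=.
  have -> : \big[Rplus/R0]_(j < p) (l (inr j) * ext 0 (fun i1 => if i1 == j then -1 else 0) (lift ord0 i))
     = - l (inr i).
    rewrite -(delta i (fun j => l (inr j))); apply: eq_bigr => j _.
    by rewrite extS eq_sym; ring.
  under eq_bigr => j _ do rewrite extS.
  move=> e; suff <- : l (inr i) = \big[Rplus/R0]_j (l (inl j) * M i j) by [].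
  by apply: (Rplus_eq_reg_r (- l (inr i))); rewrite Rplus_opp_r.
right; exists (fun k => v (lift ord0 k)).
move: cv; rewrite dotE big1 => [cv|k _]; last ring.
split=> [k|j]; first by have := hv (inr k); rewrite /= dotE delta; lra.
have v0 : 0 < v ord0 by rewrite -[R0]/0 in cv; lra.
have := hv (inl j); rewrite /= dotE Rmult_1_l => h.
apply: (Rplus_lt_reg_l (v ord0)); rewrite Rplus_0_r; exact: Rle_lt_trans h v0.
Qed.

Lemma vset_ext n (S : vset n) (x y : vec n) : (forall i, x i = y i) -> S x -> S y.
Proof. by move=> /functional_extensionality ->. Qed.

(** * Finite convex combinations *)

Section Combination.
Variables (n : nat) (L : vset n).
Hypothesis cL : vconvex L.

(** Weights are normalised by their total. Each step absorbs [y j] into the seed [z], whose weight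
    becomes [a + l j]; starting from [a > 0] keeps all denominators positive. *)
Lemma convex_absorb (T : Type) (s : seq T) (P : pred T) (y : T -> vec n) (l : T -> R)
    (z : vec n) (a : R) :
  (forall j, L (y j)) -> (forall j, 0 <= l j) -> L z -> 0 < a ->
  L (fun i => (a * z i + \big[Rplus/R0]_(j <- s | P j) (l j * y j i))
              / (a + \big[Rplus/R0]_(j <- s | P j) l j)).
Proof.
move=> Ly l0; elim: s z a => [|j s IH] z a Lz a0.
  by apply: vset_ext Lz => i; rewrite !big_nil -[R0]/0; field; lra.
case Pj : (P j); last first.
  by apply: vset_ext (IH _ _ Lz a0) => i; rewrite !big_cons Pj.
have lj := l0 j; have alj : 0 < a + l j by lra.
have ht : 0 <= a / (a + l j) <= 1.
  split; first by apply: Rlt_le; apply: Rdiv_lt_0_compat; lra.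
  apply: (Rmult_le_reg_r (a + l j)) => //.
  rewrite /Rdiv Rmult_assoc Rinv_l; lra.
apply: vset_ext (IH _ _ (cL _ _ _ Lz (Ly j) ht) alj) => i.
rewrite !big_cons Pj.
have : 0 <= \big[Rplus/R0]_(k <- s | P k) l k by exact: Rsum_ge0.
by set D := bigop.body _ _ _; set E := bigop.body _ _ _ => h; field; lra.
Qed.

Lemma convex_combination (T : finType) (y : T -> vec n) (l : T -> R) :
  (forall j, L (y j)) -> (forall j, 0 <= l j) -> \big[Rplus/R0]_j l j = 1 ->
  L (fun i => \big[Rplus/R0]_j (l j * y j i)).
Proof.
move=> Ly l0 l1.
have [k lk] : exists k, 0 < l k.
  apply: NNPP => h; suff : \big[Rplus/R0]_j l j = 0 by lra.
  apply: big1 => j _; have := l0 j; case: (Rle_lt_or_eq_dec _ _ (l0 j)) => // lj.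
  by case: h; exists j.
have e : l k + \big[Rplus/R0]_(j | j != k) l j = 1.
  by rewrite -l1 [RHS](bigD1 k).
apply: vset_ext (convex_absorb _ (index_enum T) (fun j => j != k) y l (y k) (l k) Ly l0 (Ly k) lk) => i.
by rewrite e [RHS](bigD1 k) //= Rdiv_1_r.
Qed.

End Combination.

(** * Scalar variational inequalities in the forms of Minty and Stampacchia *)

Definition minty {n} (W : vec n -> vec n) (L : vset n) : vset n :=
  fun x => L x /\ forall y, L y -> 0 <= dot (W y) (vsub y x).

Definition stampacchia {n} (W : vec n -> vec n) (L : vset n) : vset n :=
  fun x => L x /\ forall y, L y -> 0 <= dot (W x) (vsub y x).

(** Continuity tested against one fixed vector at a time: it passes easily to weighted sums and
    suffices for Minty's lemma. *)
Definition weakly_continuous_on {n} (L : vset n) (W : vec n -> vec n) : Prop :=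
  forall x v eps, L x -> 0 < eps -> exists d, 0 < d /\
    forall y, L y -> vdist x y < d -> Rabs (dot (W y) v - dot (W x) v) < eps.

Lemma ge0_approx k a : 0 <= k -> (forall eps, 0 < eps -> - (k * eps) <= a) -> 0 <= a.
Proof.
move=> k0 h; case: (Rle_lt_dec 0 a) => // a0.
have p : 0 < - a / (k + 1) by apply: Rdiv_lt_0_compat; lra.
have := h _ p; have : - a / (k + 1) * (k + 1) = - a by field; lra.
nra.
Qed.

Section Variational.
Variable n : nat.
Implicit Types (K L : vset n) (W : vec n -> vec n).

(** In Minty's form the operator is evaluated at the test point, so each condition is affine in the
    unknown. *)
Lemma minty_convex W L : vconvex L -> vconvex (minty W L).
Proof.
move=> cL x y t [Lx hx] [Ly hy] ht; split; first exact: cL.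
move=> z Lz; change (0 <= dot (W z) (vsub z (vlin t x (1 - t) y))).
have := hx z Lz; have := hy z Lz; rewrite !dot_subr dot_linr; nra.
Qed.

Lemma minty_restrict W K L x : (forall y, L y -> K y) -> L x -> minty W K x -> minty W L x.
Proof. by move=> LK Lx [_ hx]; split=> // y /LK /hx. Qed.

Lemma stampacchia_minty W L x : monotone_on L W -> stampacchia W L x -> minty W L x.
Proof.
move=> mW [Lx hx]; split=> // y Ly.
by have := mW x y Lx Ly; have := hx y Ly; rewrite dot_subl; lra.
Qed.

(** If the product at [x] were negative, weak continuity would keep it negative at a point
    [x + t (y - x)] close to [x], against Minty's inequality there. *)
Lemma minty_stampacchia W L x : vconvex L -> weakly_continuous_on L W ->
  minty W L x -> stampacchia W L x.
Proof.
move=> cL cW [Lx hx]; split=> // y Ly.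
case: (Rle_lt_dec 0 (dot (W x) (vsub y x))) => // neg.
have [|d [d0 hd]] := cW x (vsub y x) (- dot (W x) (vsub y x)) Lx; first lra.
have k0 : 0 < vdist y x + 1 by have := vnorm_ge0 _ (vsub y x); rewrite -/(vdist _ _); lra.
pose t := Rmin 1 (d / (vdist y x + 1)).
have t0 : 0 < t by apply: Rmin_glb_lt; [lra | exact: Rdiv_lt_0_compat].
have t1 : t <= 1 by exact: Rmin_l.
have td : t * (vdist y x + 1) <= d.
  have := Rmin_r 1 (d / (vdist y x + 1)); rewrite -/t.
  have : d / (vdist y x + 1) * (vdist y x + 1) = d by field; lra.
  nra.
have Lt : L (vlin t y (1 - t) x) by apply: cL => //; lra.
have := hx _ Lt.
have -> : vsub (vlin t y (1 - t) x) x = vlin t (vsub y x) 0 x.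
  by apply: functional_extensionality => i; rewrite /vsub /vlin; ring.
rewrite dot_linr => ge.
have := hd _ Lt.
rewrite vdist_lin_start; last lra.
have lt : t * vdist y x < d by nra.
move=> /(_ lt) /Rabs_def2; nra.
Qed.

(** Apply [ville] to the payoff matrix of the points: the weights of the first alternative combine
    the [y j] into the required [x], and monotonicity rules out the second. *)
Lemma finite_minty W L p (y : 'I_p.+1 -> vec n) : vconvex L -> monotone_on L W ->
  (forall i, L (y i)) ->
  exists x, L x /\ forall i, 0 <= dot (W (y i)) (vsub (y i) x).
Proof.
move=> cL mW Ly.
case: (ville p.+1 (fun i j => dot (W (y i)) (vsub (y i) (y j)))) => [[l [l0 [l1 hl]]]|].
  pose x : vec n := fun i => \big[Rplus/R0]_j (l j * y j i).
  exists x; split; first exact: convex_combination.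
  move=> i; have := hl i.
  suff -> : dot (W (y i)) (vsub (y i) x) =
     \big[Rplus/R0]_j (l j * dot (W (y i)) (vsub (y i) (y j))) by [].
  have -> : \big[Rplus/R0]_j (l j * dot (W (y i)) (vsub (y i) (y j)))
     = dot (W (y i)) (y i) * \big[Rplus/R0]_j l j
       + (-1) * \big[Rplus/R0]_j (l j * dot (W (y i)) (y j)).
    by rewrite -Rsum_lin; apply: eq_bigr => j _; rewrite dot_subr; ring.
  rewrite l1 dot_subr; suff -> : dot (W (y i)) x = \big[Rplus/R0]_j (l j * dot (W (y i)) (y j)) by ring.
  rewrite /dot /x; under [RHS]eq_bigr => j _ do rewrite -Rsum_scal.
  rewrite exchange_big /=; apply: eq_bigr => k _.
  by rewrite -Rsum_scal; apply: eq_bigr => j _; ring.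
move=> [u [u0 hu]].
(* By monotonicity the quadratic form of the payoff matrix is nonnegative on the orthant. *)
pose q i j := dot (W (y i)) (vsub (y i) (y j)).
pose S := \big[Rplus/R0]_i \big[Rplus/R0]_j (u i * (u j * q i j)).
(* The entries at [(i, j)] and [(j, i)] add up to a monotonicity product. *)
have S0 : 0 <= S + S.
  rewrite {2}/S exchange_big /= -big_split /=.
  apply: Rsum_ge0 => i; rewrite -big_split /=; apply: Rsum_ge0 => j.
  have := mW _ _ (Ly i) (Ly j); rewrite /q !dot_subl !dot_subr => h.
  by have := u0 i; have := u0 j; have := Rmult_le_pos _ _ (u0 i) (u0 j); nra.
have SE : S = \big[Rplus/R0]_j (u j * \big[Rplus/R0]_i (q i j * u i)).
  rewrite /S exchange_big /=; apply: eq_bigr => j _.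
  by rewrite -Rsum_scal; apply: eq_bigr => i _; ring.
(* If [u] vanished, the strictly negative sum for [ord0] would be 0. *)
have [k uk] : exists k, 0 < u k.
  apply: NNPP => h; have := hu ord0; rewrite big1 -[R0]/0; first lra.
  move=> i _; case: (Rle_lt_or_eq_dec _ _ (u0 i)) => [ui|<-]; last ring.
  by case: h; exists i.
suff : 0 < - S by lra.
have -> : - S = \big[Rplus/R0]_j (u j * - \big[Rplus/R0]_i (q i j * u i)).
  have -> : - S = -1 * S by ring.
  by rewrite SE -Rsum_scal; apply: eq_bigr => j _; ring.
by apply: (Rsum_gt0 _ _ k) => [j|]; [have := u0 j; have := hu j | have := hu k];
  rewrite -/(q _ _); set z := bigop.body _ _ _ => hz; nra.
Qed.

End Variational.

Lemma halfspace_closed n (w y x : vec n) :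
  (forall eps, 0 < eps -> exists x', 0 <= dot w (vsub y x') /\ vdist x x' < eps) ->
  0 <= dot w (vsub y x).
Proof.
move=> h; apply: (ge0_approx _ _ (vnorm_ge0 _ w)) => eps e0.
have [x' [h1 h2]] := h eps e0.
have := cauchy_schwarz _ w (vsub x x'); rewrite -/(vdist x x') => cs.
have := Rle_abs (dot w (vsub x x')); have := vnorm_ge0 _ w.
have : dot w (vsub y x') = dot w (vsub y x) + dot w (vsub x x') by rewrite !dot_subr; ring.
nra.
Qed.

(** Finitely many Minty inequalities are solvable by [finite_minty]; a cluster point of these
    solutions satisfies all of them, each being a closed condition. *)
Lemma minty_exists n (W : vec n -> vec n) (L : vset n) (r : R) :
  vclosed L -> vconvex L -> (exists x, L x) -> (forall x, L x -> vnorm x <= r) ->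
  monotone_on L W -> exists x, minty W L x.
Proof.
move=> clL cL [z Lz] bL mW.
pose z0 : {y | L y} := exist _ z Lz.
(* The index [i] ranges over all naturals, so the inequality for the default [z0] is always
   included. Concatenating lists makes the family directed. *)
pose B (s : seq {y | L y}) : vset n := fun x => L x /\
  forall i, 0 <= dot (W (sval (nth z0 s i))) (vsub (sval (nth z0 s i)) x).
have [||| c hc] := cluster_point n _ [::] B r.
- move=> s t; exists (s ++ t) => x [Lx hx]; split; split=> // i.
    case: (ltnP i (size s)) => his; first by have := hx i; rewrite nth_cat his.
    have := hx (addn (size s) (size t)); rewrite !nth_default // size_cat //; exact: leqnn.
  have := hx (addn (size s) i); rewrite nth_cat ltnNge leq_addr /= addKn //.
- move=> s.
  (* The [(size s).+1] indices list the entries of [s] and then the default [z0]. *)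
  have [x [Lx hx]] := finite_minty n W L (size s) (fun i => sval (nth z0 s i)) cL mW (fun i => svalP _).
  exists x; split=> // i; case: (ltnP i (size s)) => his.
    have hi : leq i.+1 (size s).+1 by exact: ltnW.
    exact: (hx (Ordinal hi)).
  by rewrite nth_default //; have := hx ord_max; rewrite nth_default.
- by move=> s x [/bL].
exists c; split.
  apply: (vclosedP _ _ _ clL) => eps e0; have [x [[Lx _] cx]] := hc [::] eps e0.
  by exists x.
move=> y Ly; apply: halfspace_closed => eps e0.
have [x [[_ hx] cx]] := hc [:: exist _ y Ly] eps e0.
by exists x; split=> //; exact: (hx O).
Qed.

Lemma convex_lt s a b e : 0 <= s <= 1 -> a < e -> b < e -> (1 - s) * a + s * b < e.
Proof.
move=> hs ae be; case: (Req_dec s 0) => [->|s0]; first lra.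
have : s * b < s * e by apply: Rmult_lt_compat_l; lra.
have : (1 - s) * a <= (1 - s) * e by apply: Rmult_le_compat_l; lra.
lra.
Qed.

(** * Segments of operators and the closed graph of their solutions *)

Section Homotopy.
Variables (n : nat) (W0 W1 : vec n -> vec n).

Definition mix (s : R) : vec n -> vec n := fun x => vlin (1 - s) (W0 x) s (W1 x).

Lemma dot_mix s x v : dot (mix s x) v = (1 - s) * dot (W0 x) v + s * dot (W1 x) v.
Proof. exact: dot_linl. Qed.

Lemma mix_monotone K s : 0 <= s <= 1 -> monotone_on K W0 -> monotone_on K W1 ->
  monotone_on K (mix s).
Proof.
move=> hs m0 m1 x y Kx Ky; have := m0 x y Kx Ky; have := m1 x y Kx Ky.
by rewrite !dot_subl !dot_mix; nra.
Qed.

Lemma mix_weakly_continuous K s : 0 <= s <= 1 -> weakly_continuous_on K W0 ->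
  weakly_continuous_on K W1 -> weakly_continuous_on K (mix s).
Proof.
move=> hs c0 c1 x v eps Kx e0.
have [d [d0 hd]] := c0 x v eps Kx e0; have [f [f0 hf]] := c1 x v eps Kx e0.
exists (Rmin d f); split; first exact: Rmin_glb_lt.
move=> y Ky xy; have [h1 h2] := (Rmin_l d f, Rmin_r d f).
have := hd y Ky; have := hf y Ky; rewrite !dot_mix.
have yd : vdist x y < d by lra.
have yf : vdist x y < f by lra.
move=> /(_ yf) /Rabs_def2 hyf /(_ yd) /Rabs_def2 hyd; apply: Rabs_def1.
  have := convex_lt s _ _ eps hs (proj1 hyd) (proj1 hyf); lra.
set a := dot (W0 y) v in hyd *; set b := dot (W1 y) v in hyf *.
set a' := dot (W0 x) v in hyd *; set b' := dot (W1 x) v in hyf *.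
have := convex_lt s (a' - a) (b' - b) eps hs; lra.
Qed.

Lemma minty_closed_graph L t x : vclosed L -> 0 <= t <= 1 ->
  (forall eps, 0 < eps -> exists s x', 0 <= s <= 1 /\ Rabs (s - t) < eps /\
     minty (mix s) L x' /\ vdist x x' < eps) ->
  minty (mix t) L x.
Proof.
move=> clL ht lim; split.
  apply: (vclosedP _ _ _ clL) => eps e0; have [s [x' [_ [_ [[Lx' _] xx']]]]] := lim eps e0.
  by exists x'.
move=> y Ly.
(* The norms pay for replacing [x'] by [x], via Cauchy-Schwarz; the absolute values pay for
   replacing [s] by [t]. *)
pose k := vnorm (W0 y) + vnorm (W1 y)
  + Rabs (dot (W0 y) (vsub y x)) + Rabs (dot (W1 y) (vsub y x)).
have [a0 [a1 [b0 b1]]] := (vnorm_ge0 _ (W0 y), (vnorm_ge0 _ (W1 y),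
  (Rabs_pos (dot (W0 y) (vsub y x)), Rabs_pos (dot (W1 y) (vsub y x))))).
apply: (ge0_approx k) => [|eps e0]; first by rewrite /k; lra.
have [s [x' [hs [/Rabs_def2 st [[_ hx'] xx']]]]] := lim eps e0.
have := hx' y Ly.
have split_dot w : dot w (vsub y x') = dot w (vsub y x) + dot w (vsub x x').
  by rewrite !dot_subr; ring.
rewrite !dot_mix !split_dot.
have cs0 := cauchy_schwarz _ (W0 y) (vsub x x').
have cs1 := cauchy_schwarz _ (W1 y) (vsub x x').
have le0 := Rle_abs (dot (W0 y) (vsub x x')).
have le1 := Rle_abs (dot (W1 y) (vsub x x')).
move: cs0 cs1; rewrite -/(vdist x x') => cs0 cs1.
have d0 : dot (W0 y) (vsub x x') <= vnorm (W0 y) * eps by nra.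
have d1 : dot (W1 y) (vsub x x') <= vnorm (W1 y) * eps by nra.
have prod a : (s - t) * a <= eps * Rabs a.
  apply: (Rle_trans _ _ _ (Rle_abs _)); rewrite Rabs_mult.
  apply: Rmult_le_compat_r; first exact: Rabs_pos.
  by apply: Rlt_le; apply: Rabs_def1; lra.
have p1 := prod (dot (W1 y) (vsub y x)).
have p0 := prod (- dot (W0 y) (vsub y x)); rewrite Rabs_Ropp in p0.
have q0 : (1 - s) * dot (W0 y) (vsub x x') <= vnorm (W0 y) * eps.
  have : 0 <= vnorm (W0 y) * eps by nra.
  by nra.
have q1 : s * dot (W1 y) (vsub x x') <= vnorm (W1 y) * eps.
  have : 0 <= vnorm (W1 y) * eps by nra.
  by nra.
rewrite /k; move: p0 p1 q0 q1; clear; nra.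
Qed.

(** Compactness combined with the closed graph. The relation [A] records a property of the
    approximating pairs that is wanted next to the limit solution, usually in an argument by
    contradiction. *)
Lemma minty_cluster L t r (A : R -> vset n) : vclosed L -> 0 <= t <= 1 ->
  (forall eps, 0 < eps -> exists s x, 0 <= s <= 1 /\ Rabs (s - t) < eps /\
     minty (mix s) L x /\ A s x /\ vnorm x <= r) ->
  exists x, minty (mix t) L x /\
    forall eps, 0 < eps -> exists s x', 0 <= s <= 1 /\ Rabs (s - t) < eps /\
     minty (mix s) L x' /\ A s x' /\ vdist x x' < eps.
Proof.
move=> clL ht ne.
pose B (e : posreal) : vset n := fun x => vnorm x <= r /\
  exists s, 0 <= s <= 1 /\ Rabs (s - t) < e /\ minty (mix s) L x /\ A s x.
have one : 0 < 1 by lra.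
have [||| c hc] := cluster_point n _ (mkposreal 1 one) B r.
- move=> e f; have m0 : 0 < Rmin e f by apply: Rmin_glb_lt; [case: (e) | case: (f)].
  exists (mkposreal _ m0) => x [xr [s [hs [st [Sx As]]]]] /=.
  have [h1 h2] := (Rmin_l e f, Rmin_r e f); rewrite /= in st.
  by split; split=> //; exists s; split=> //; split=> //; lra.
- by move=> [e e0]; have [s [x [hs [st [Sx [As xr]]]]]] := ne e e0; exists x; split=> //; exists s.
- by move=> e x [].
have lim eps : 0 < eps -> exists s x', 0 <= s <= 1 /\ Rabs (s - t) < eps /\
     minty (mix s) L x' /\ A s x' /\ vdist c x' < eps.
  move=> e0; have [x [[_ [s [hs [st [Sx As]]]]] cx]] := hc (mkposreal _ e0) eps e0.
  by exists s, x.
exists c; split=> //; apply: minty_closed_graph => // eps /lim.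
by move=> [s [x [hs [st [Sx [_ cx]]]]]]; exists s, x.
Qed.

End Homotopy.

(** * Truncation of the feasible set by a ball *)

Definition truncate {n} (K : vset n) (r : R) : vset n := fun x => K x /\ vnorm x <= r.

Lemma truncate_convex n (K : vset n) r : vconvex K -> vconvex (truncate K r).
Proof.
move=> cK x y t [Kx xr] [Ky yr] ht; split; first exact: cK.
exact: (ball_convex n r x y t).
Qed.

Lemma truncate_closed n (K : vset n) r : vclosed K -> vclosed (truncate K r).
Proof.
move=> clK x nx.
apply: NNPP => h; apply: nx.
have lim eps : 0 < eps -> exists y, truncate K r y /\ vdist x y < eps.
  move=> e0; apply: NNPP => h'; apply: h; exists eps; split=> // y xy Ky.
  by apply: h'; exists y.
split.
  apply: (vclosedP _ _ _ clK) => eps /lim [y [[Ky _] xy]]; by exists y.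
case: (Rle_lt_dec (vnorm x) r) => // lt.
have [|y [[_ yr] xy]] := lim (vnorm x - r); first lra.
by have := vnorm_triangle _ x y; lra.
Qed.

(** From a point strictly inside the ball, a short step towards any [y] in [K] stays in the
    truncated set, and Stampacchia's inequality scales with the step length. *)
Lemma minty_untruncate n (W : vec n -> vec n) (K : vset n) r x :
  vconvex K -> monotone_on K W -> weakly_continuous_on K W ->
  minty W (truncate K r) x -> vnorm x < r -> minty W K x.
Proof.
move=> cK mW cW mx xr.
have [Kx _] : truncate K r x by case: mx.
have cW' : weakly_continuous_on (truncate K r) W.
  move=> u v eps [Ku _] e0; have [d [d0 hd]] := cW u v eps Ku e0.
  by exists d; split=> // y [Ky _]; exact: hd.
have [_ sx] := minty_stampacchia _ _ _ _ (truncate_convex _ _ r cK) cW' mx.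
apply: stampacchia_minty => //; split=> // y Ky.
have k0 : 0 < vdist y x + 1 by have := vnorm_ge0 _ (vsub y x); rewrite -/(vdist _ _); lra.
pose t := Rmin 1 ((r - vnorm x) / (vdist y x + 1)).
have t0 : 0 < t by apply: Rmin_glb_lt; [lra | apply: Rdiv_lt_0_compat; lra].
have t1 : t <= 1 by exact: Rmin_l.
have td : t * (vdist y x + 1) <= r - vnorm x.
  have := Rmin_r 1 ((r - vnorm x) / (vdist y x + 1)); rewrite -/t.
  have : (r - vnorm x) / (vdist y x + 1) * (vdist y x + 1) = r - vnorm x by field; lra.
  nra.
have Lt : truncate K r (vlin t y (1 - t) x).
  split; first by apply: cK => //; lra.
  have := vnorm_triangle _ (vlin t y (1 - t) x) x; rewrite vdistC vdist_lin_start; last lra.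
  by lra.
have := sx _ Lt; rewrite !dot_subr dot_linr; nra.
Qed.

(** * Stability of solution sets along the homotopy *)

Section Stability.
Variables (n : nat) (W0 W1 : vec n -> vec n) (K : vset n).
Hypotheses (clK : vclosed K) (cK : vconvex K).
Hypotheses (m0 : monotone_on K W0) (m1 : monotone_on K W1).
Hypotheses (c0 : weakly_continuous_on K W0) (c1 : weakly_continuous_on K W1).

Notation S s := (minty (mix n W0 W1 s) K).
Notation S' r s := (minty (mix n W0 W1 s) (truncate K r)).

Let mono s (hs : 0 <= s <= 1) : monotone_on K (mix n W0 W1 s) := mix_monotone n W0 W1 K s hs m0 m1.
Let wcont s (hs : 0 <= s <= 1) : weakly_continuous_on K (mix n W0 W1 s) :=
  mix_weakly_continuous n W0 W1 K s hs c0 c1.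

(* A solution of the truncated problem beyond the ball of radius [M] would give, by convexity, one of norm [M + 1 / 2], which solves the full problem. *)
Lemma truncated_solution_bound t M x0 : 0 <= t <= 1 ->
  S t x0 -> (forall x, S t x -> vnorm x <= M) ->
  forall x, S' (M + 1) t x -> vnorm x <= M.
Proof.
move=> ht Sx0 bM x Sx; case: (Rle_lt_dec (vnorm x) M) => // lt.
have x0M := bM _ Sx0.
case: (Rlt_le_dec (vnorm x) (M + 1)) => le.
  by apply: bM; apply: minty_untruncate (Sx) le => //; [exact: mono | exact: wcont].
have Sx0' : S' (M + 1) t x0.
  apply: minty_restrict (Sx0); first by move=> y [].
  by split; [case: Sx0 | lra].
have [||u [hu nu]] := norm_between n x0 x (M + 1 / 2); try lra.
have Su : S' (M + 1) t (vlin u x (1 - u) x0).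
  by apply: minty_convex => //; exact: truncate_convex.
have := bM (vlin u x (1 - u) x0); rewrite nu => h.
suff : M + 1 / 2 <= M by lra.
by apply: h; apply: minty_untruncate (Su) _ => //; [exact: mono | exact: wcont | lra].
Qed.

Lemma solution_stability t M x0 : 0 <= t <= 1 ->
  S t x0 -> (forall x, S t x -> vnorm x <= M) ->
  exists d, 0 < d /\ forall s, 0 <= s <= 1 -> Rabs (s - t) < d ->
    (exists x, S s x) /\ forall x, S s x -> vnorm x <= M + 1.
Proof.
move=> ht Sx0 bM.
(* Otherwise truncated solutions on the sphere of radius [M + 1] cluster at one for [t], whose norm
   is at most [M]. *)
have [d [d0 hd]] : exists d, 0 < d /\ forall s, 0 <= s <= 1 -> Rabs (s - t) < d ->
    forall x, S' (M + 1) s x -> vnorm x < M + 1.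
  apply: NNPP => h.
  have [|x [Sx hx]] := minty_cluster n W0 W1 (truncate K (M + 1)) t (M + 1)
     (fun _ x => M + 1 <= vnorm x) (truncate_closed _ _ _ clK) ht.
    move=> eps e0; apply: NNPP => h'; apply: h; exists eps; split=> // s hs st x Sx.
    case: (Rlt_le_dec (vnorm x) (M + 1)) => // le; case: h'; exists s, x.
    by do !split=> //; case: Sx => [[]].
  have xM := truncated_solution_bound t M x0 ht Sx0 bM x Sx.
  have [|s [x' [_ [_ [_ [le xx']]]]]] := hx 1; first lra.
  by have := vnorm_triangle _ x' x; rewrite vdistC; lra.
have Kx0 : truncate K (M + 1) x0 by split; [case: Sx0 | have := bM _ Sx0; lra].
exists d; split=> // s hs st.
have [x Sx] : exists x, S' (M + 1) s x.
  apply: (minty_exists n _ _ (M + 1)).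
  - exact: truncate_closed.
  - exact: truncate_convex.
  - by exists x0.
  - by move=> y [].
  - by move=> y z [Ky _] [Kz _]; exact: mono.
have xM := hd s hs st x Sx.
have Sx' : S s x by apply: minty_untruncate (Sx) xM => //; [exact: mono | exact: wcont].
split; first by exists x.
move=> z Sz; case: (Rle_lt_dec (vnorm z) (M + 1)) => // lt.
(* A solution beyond the ball, joined to [x], would yield a solution on the sphere, which [hd]
   excludes. *)
have [||u [hu nu]] := norm_between n x z (M + 1); try lra.
have Su : S s (vlin u z (1 - u) x) by apply: minty_convex.
have Su' : S' (M + 1) s (vlin u z (1 - u) x).
  apply: minty_restrict (Su); first by move=> y [].
  by split; [case: Su | lra].
by have := hd s hs st _ Su'; lra.
Qed.

(** Each solution set is convex, hence on one side of a separation; by the closed graph and the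
    common bound, that side is locally constant on the interval [J]. *)
Lemma solutions_union_connected (J : R -> Prop) r :
  (forall s, J s -> 0 <= s <= 1) ->
  (forall u v w, J u -> J v -> 0 <= w <= 1 -> J (u + w * (v - u))) ->
  (forall s, J s -> exists x, S s x) ->
  (forall s, J s -> forall x, S s x -> vnorm x <= r) ->
  vconnected (fun x => exists s, J s /\ S s x).
Proof.
move=> J01 cJ ne bd [U [V [oU [oV [cov [[x [[a [Ja Sx]] Ux]] [[y [[b [Jb Sy]] Vy]] dis]]]]]]].
have one_side s : J s -> (forall z, S s z -> U z) \/ (forall z, S s z -> V z).
  move=> Js; apply: NNPP => h; case: (convex_connected n (S s)).
    exact: minty_convex.
  exists U, V; do 2!split=> //; split=> [z Sz|]; first by apply: cov; exists s.
  split; [|split].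
  - apply: NNPP => h'; apply: h; right=> z Sz; case: (cov z) => //; first by exists s.
    by move=> Uz; case: h'; exists z.
  - apply: NNPP => h'; apply: h; left=> z Sz; case: (cov z) => //; first by exists s.
    by move=> Vz; case: h'; exists z.
  - by move=> z Sz; apply: dis; exists s.
pose P s := exists z, S s z /\ U z.
have PU s : J s -> P s -> forall z, S s z -> U z.
  move=> Js [w [Sw Uw]]; case: (one_side s Js) => // h z Sz.
  by case: (dis w) => //; [exists s | exact: h].
have nPV s : J s -> ~ P s -> forall z, S s z -> V z.
  move=> Js nP z Sz; case: (cov z) => //; first by exists s.
  by move=> Uz; case: nP; exists z.
have Pb : P b; last by apply: (dis y) => //; [exists b | exact: (PU b)].
apply: (locally_constant J P a b cJ) => //; last by exists x.
move=> t Jt; apply: NNPP => h.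
(* Parameters on the other side than [t] would accumulate at [t], and so would some of their
   solutions at a solution [z] for [t]. *)
have [|z [Sz hz]] := minty_cluster n W0 W1 K t r (fun s _ => J s /\ ~ (P s <-> P t)) clK (J01 _ Jt).
  move=> eps e0; apply: NNPP => h'; apply: h; exists eps; split=> // s Js st.
  apply: NNPP => h; apply: h'; have [w Sw] := ne s Js; exists s, w.
  by split; [exact: J01 | do 3!split=> //; exact: bd Sw].
case: (classic (P t)) => Pt.
  have [e [e0 he]] := oU z (PU t Jt Pt z Sz).
  have [s [w [_ [_ [Sw [[Js ns] zw]]]]]] := hz e e0.
  by case: ns; split=> // _; exists w; split=> //; exact: he.
have [e [e0 he]] := oV z (nPV t Jt Pt z Sz).
have [s [w [_ [_ [Sw [[Js ns] zw]]]]]] := hz e e0.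
case: ns; split=> // Ps; case: (dis w); [by exists s | exact: (PU s) | exact: he].
Qed.

Lemma solutions_in_component (A : vset n) x0 M :
  (forall s x, 0 <= s <= 1 -> S s x -> A x) -> S 0 x0 ->
  (forall x, vcomponent A x0 x -> vnorm x <= M) ->
  forall x, S 1 x -> vcomponent A x0 x.
Proof.
move=> SA Sx0 bC.
pose C := vcomponent A x0.
have cvx s : vconvex (S s) by exact: minty_convex.
have meets s z : 0 <= s <= 1 -> S s z -> C z -> forall x, S s x -> C x.
  move=> hs Sz Cz; apply: (component_maximal n A x0 (S s) z) => //.
    exact: convex_connected.
  by move=> y; exact: SA.
pose P s := exists z, S s z /\ C z.
have P1 : P 1; last by move: P1 => [z [Sz Cz]]; apply: (meets 1 z) => //; lra.
apply: (locally_constant_unit P); last first.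
  exists x0; split=> //; apply: component_self; apply: SA (Sx0); lra.
move=> t ht; case: (classic (P t)) => Pt.
  have [z [Sz Cz]] := Pt; have SC := meets t z ht Sz Cz.
  (* Openness: the solution sets for parameters near [t] have a connected union that meets the
     component, so they all lie in it. *)
  have [|d [d0 hd]] := solution_stability t M z ht Sz; first by move=> x /SC /bC.
  exists d; split=> // s hs st; split=> // _.
  pose J u := 0 <= u <= 1 /\ Rabs (u - t) < d.
  have [y Sy] := proj1 (hd s hs st); exists y; split=> //.
  apply: (component_maximal n A x0 (fun x => exists u, J u /\ S u x) z) => //.
  - apply: (solutions_union_connected J (M + 1)).
    + by move=> u [].
    + move=> u v w [hu /Rabs_def2 du] [hv /Rabs_def2 dv] hw; split; first by split; nra.
      apply: Rabs_def1.
        by have := convex_lt w (u - t) (v - t) d hw; lra.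
      by have := convex_lt w (t - u) (t - v) d hw; lra.
    + by move=> u [hu /(hd u hu) []].
    + by move=> u [hu /(hd u hu) []].
  - by move=> x [u [[hu _] Su]]; exact: SA Su.
  - by exists t; split=> //; split=> //; rewrite Rminus_diag Rabs_R0.
  - by exists s.
apply: NNPP => h; apply: (Pt).
(* Closedness: solutions in [C] for parameters tending to [t] stay bounded by [M] and cluster at a
   solution [z]; adjoining [z] to [C] keeps it connected, so [z] lies in [C]. *)
have [|z [Sz hz]] := minty_cluster n W0 W1 K t M (fun _ => C) clK ht.
  move=> eps e0; apply: NNPP => h'; apply: h; exists eps; split=> // s hs st.
  split=> [[z [Sz Cz]]|[z [Sz Cz]]]; first by case: h'; exists s, z; do 4!split=> //; exact: bC.
  by case: Pt; exists z.
exists z; split=> //.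
apply: (component_maximal n A x0 (fun y => C y \/ y = z) x0); last by right.
- apply: add_limit_connected; first exact: component_connected.
  by move=> eps /hz [s [w [_ [_ [_ [Cw zw]]]]]]; exists w.
- move=> y [/component_sub //|->]; exact: SA (Sz).
- apply: component_self; apply: SA (Sx0); lra.
- left; apply: component_self; apply: SA (Sx0); lra.
Qed.

End Stability.

(** * Pareto solutions and positive weights *)

Section Scalarization.
Variables (n m : nat) (F : 'I_m -> vec n -> vec n) (K : vset n).

Definition weighted (xi : 'I_m -> R) : vec n -> vec n :=
  fun x i => \big[Rplus/R0]_(l < m) (xi l * F l x i).

Lemma dot_weighted xi x v :
  dot (weighted xi x) v = \big[Rplus/R0]_(l < m) (xi l * dot (F l x) v).
Proof.
rewrite /dot; under [RHS]eq_bigr => l _ do rewrite -Rsum_scal.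
rewrite exchange_big /=; apply: eq_bigr => i _.
by rewrite /weighted Rmult_comm -Rsum_scal; apply: eq_bigr => l _; ring.
Qed.

Lemma weighted_monotone xi : (forall l, 0 <= xi l) ->
  (forall l, monotone_on K (F l)) -> monotone_on K (weighted xi).
Proof.
move=> xi0 mF x y Kx Ky; rewrite dot_subl !dot_weighted.
have -> : \big[Rplus/R0]_(l < m) (xi l * dot (F l y) (vsub y x))
   - \big[Rplus/R0]_(l < m) (xi l * dot (F l x) (vsub y x))
   = 1 * \big[Rplus/R0]_(l < m) (xi l * dot (F l y) (vsub y x))
   + -1 * \big[Rplus/R0]_(l < m) (xi l * dot (F l x) (vsub y x)) by ring.
rewrite -Rsum_lin; apply: Rsum_ge0 => l.
by have := mF l x y Kx Ky; have := xi0 l; rewrite dot_subl; nra.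
Qed.

Lemma continuous_weakly (G : vec n -> vec n) :
  continuous_on K G -> weakly_continuous_on K G.
Proof.
move=> cG x v eps Kx e0; have v0 := vnorm_ge0 _ v.
have p : 0 < eps / (vnorm v + 1) by apply: Rdiv_lt_0_compat; lra.
have [d [d0 hd]] := cG x _ Kx p; exists d; split=> // y Ky xy.
have := hd y Ky xy; rewrite vdistC => lt.
have := cauchy_schwarz _ (vsub (G y) (G x)) v; rewrite dot_subl -/(vdist _ _) => cs.
have : eps / (vnorm v + 1) * (vnorm v + 1) = eps by field; lra.
have := vnorm_ge0 _ (vsub (G y) (G x)); rewrite -/(vdist _ _); nra.
Qed.

Lemma weighted_weakly_continuous xi : (forall l, weakly_continuous_on K (F l)) ->
  weakly_continuous_on K (weighted xi).
Proof.
move=> cF x v eps Kx.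
suff h (s : seq 'I_m) : forall eps, 0 < eps -> exists d, 0 < d /\
    forall y, K y -> vdist x y < d ->
    Rabs (\big[Rplus/R0]_(l <- s) (xi l * dot (F l y) v)
          - \big[Rplus/R0]_(l <- s) (xi l * dot (F l x) v)) < eps.
  move=> /(h (index_enum 'I_m)) [d [d0 hd]]; exists d; split=> // y Ky xy.
  by rewrite !dot_weighted; exact: hd.
elim: s {eps} => [|l s IH] eps e0.
  by exists 1; split=> [|y _ _]; [lra | rewrite !big_nil Rminus_diag Rabs_R0].
have [|d [d0 hd]] := IH (eps / 2); first lra.
have a0 := Rabs_pos (xi l).
have p : 0 < eps / 2 / (Rabs (xi l) + 1) by apply: Rdiv_lt_0_compat; lra.
have [f [f0 hf]] := cF l x v _ Kx p.
exists (Rmin d f); split; first exact: Rmin_glb_lt.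
move=> y Ky xy; have [h1 h2] := (Rmin_l d f, Rmin_r d f).
have yd : vdist x y < d by lra.
have yf : vdist x y < f by lra.
have := hd y Ky yd; have := hf y Ky yf; rewrite !big_cons.
set S := bigop.body _ _ _; set S' := bigop.body _ _ _.
set a := dot _ _; set b := dot _ _ => ab SS.
have -> : xi l * a + S - (xi l * b + S') = xi l * (a - b) + (S - S') by ring.
apply: Rle_lt_trans (Rabs_triang _ _) _; rewrite Rabs_mult.
have : eps / 2 / (Rabs (xi l) + 1) * (Rabs (xi l) + 1) = eps / 2 by field; lra.
have := Rabs_pos (a - b); nra.
Qed.

(** A violating [y] gives nonnegative products, one of them nonzero, so positive weights make their
    sum strictly positive. *)
Lemma weighted_solution_pareto xi x : (forall l, 0 < xi l) ->
  stampacchia (weighted xi) K x -> Sol F K x.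
Proof.
move=> xi0 [Kx hx]; split=> // y Ky [ge [l ne]].
have := hx y Ky.
have -> : dot (weighted xi x) (vsub y x) = - dot (weighted xi x) (vsub x y).
  by rewrite !dot_subr; ring.
rewrite dot_weighted; suff : 0 < \big[Rplus/R0]_(l < m) (xi l * dot (F l x) (vsub x y)) by lra.
apply: (Rsum_gt0 _ _ l) => [k|]; first by have := xi0 k; have := ge k; nra.
have := ge l; have := xi0 l => h1 h2.
by apply: Rmult_lt_0_compat => //; lra.
Qed.

(** Active constraints do not grow along [v], and the finitely many inactive ones leave a positive
    slack. *)
Lemma feasible_step (p : nat) (a : 'I_p -> vec n) (b : 'I_p -> R) (x v : vec n) :
  (forall j, dot (a j) x <= b j) ->
  (forall j, dot (a j) x = b j -> dot (a j) v <= 0) ->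
  exists t, 0 < t /\ forall j, dot (a j) x + t * dot (a j) v <= b j.
Proof.
move=> feas act.
(* Allowing all smaller steps [u] lets the induction pass to a minimum. *)
suff h (s : seq 'I_p) : exists t, 0 < t /\ forall u j, 0 < u <= t -> j \in s ->
    dot (a j) x + u * dot (a j) v <= b j.
  have [t [t0 ht]] := h (enum 'I_p); exists t; split=> // j.
  by apply: ht; [lra | rewrite mem_enum].
elim: s => [|j s [t [t0 ht]]]; first by exists 1; split=> //; lra.
have [e [e0 he]] : exists e, 0 < e /\ forall u, 0 < u <= e -> dot (a j) x + u * dot (a j) v <= b j.
  have fj := feas j.
  case: (Rle_lt_dec (dot (a j) v) 0) => av; first by exists 1; split=> [|u hu]; [lra | nra].
  have ab : dot (a j) x < b j.
    by case: (Req_dec (dot (a j) x) (b j)) => [/act|]; lra.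
  exists ((b j - dot (a j) x) / dot (a j) v); split; first by apply: Rdiv_lt_0_compat; lra.
  move=> u hu; have : (b j - dot (a j) x) / dot (a j) v * dot (a j) v = b j - dot (a j) x.
    by field; lra.
  nra.
exists (Rmin t e); split; first exact: Rmin_glb_lt.
have [h1 h2] := (Rmin_l t e, Rmin_r t e).
by move=> u k hu; rewrite inE => /orP [/eqP ->|ks]; [apply: he; lra | apply: ht => //; lra].
Qed.

(* The absence of a feasible direction decreasing [F l] and increasing no [F k] turns, by Farkas, into multipliers in which [F l] has coefficient at least 1; adding them up over [l] makes all weights positive. *)
Lemma pareto_weighted_solution x : vpolyhedral K -> Sol F K x ->
  exists xi, (forall l, 0 < xi l) /\ stampacchia (weighted xi) K x.
Proof.
move=> [p [a [b Kab]]] [Kx par].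
have feas := proj1 (Kab x) Kx.
have one l : exists nu : 'I_m -> R, (forall k, 0 <= nu k) /\
    forall y, K y -> 0 <= dot (F l x) (vsub y x)
      + \big[Rplus/R0]_(k < m) (nu k * dot (F k x) (vsub y x)).
  (* Inactive constraints become the zero vector, so Farkas can keep the index type ['I_p]. *)
  pose act j : vec n := fun i => if Req_dec_T (dot (a j) x) (b j) then a j i else 0.
  pose f (j : 'I_p + 'I_m) : vec n := match j with inl j => act j | inr k => F k x end.
  have actE j v : dot (act j) v = if Req_dec_T (dot (a j) x) (b j) then dot (a j) v else 0.
    by rewrite /act; case: (Req_dec_T (dot (a j) x) (b j)) => [e|e] //; apply: big1 => i _; exact: Rmult_0_l.
  have actK j y : K y -> dot (act j) (vsub y x) <= 0.
    move=> /Kab Ky; rewrite actE; case: (Req_dec_T (dot (a j) x) (b j)) => [e|e] /=; last lra.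
    by rewrite dot_subr e; have := Ky j; lra.
  case: (farkas n _ f (vlin (-1) (F l x) 0 (F l x))) => [[lam [lam0 hlam]]|[v [hv neg]]].
    exists (fun k => lam (inr k)); split=> // y Ky.
    have e : - dot (F l x) (vsub y x) = \big[Rplus/R0]_j (lam j * dot (f j) (vsub y x)).
      have -> : - dot (F l x) (vsub y x) = dot (vlin (-1) (F l x) 0 (F l x)) (vsub y x).
        by rewrite dot_linl; ring.
      rewrite /dot; under [RHS]eq_bigr => j _ do rewrite -Rsum_scal.
      rewrite exchange_big /=; apply: eq_bigr => i _.
      by rewrite hlam Rmult_comm -Rsum_scal; apply: eq_bigr => j _; ring.
    rewrite big_sumType /= in e.
    have le : \big[Rplus/R0]_(j < p) (lam (inl j) * dot (act j) (vsub y x)) <= 0.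
      elim/big_rec: _ => [|j z _ hz]; first lra.
      have h : lam (inl j) * dot (act j) (vsub y x) <= 0.
        by have := lam0 (inl j); have := actK j y Ky; nra.
      by apply: Rle_trans (Rplus_le_compat _ _ _ _ h hz) _; lra.
    move: e le; set A := bigop.body _ _ _; set B := bigop.body _ _ _; lra.
  (* The separator is a feasible direction along which [F l] strictly decreases and no [F k]
     increases, contradicting Pareto optimality. *)
  exfalso.
  have neg' : dot (F l x) v < 0 by move: neg; rewrite dot_linl; lra.
  have [|t [t0 ht]] := feasible_step p a b x v feas.
    by move=> j e; have := hv (inl j); rewrite /= actE; case: Req_dec_T.
  have Ky : K (vlin 1 x t v) by apply/Kab => j; rewrite dot_linr Rmult_1_l.
  have dE k : dot (F k x) (vsub x (vlin 1 x t v)) = - (t * dot (F k x) v).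
    by rewrite dot_subr dot_linr; ring.
  apply: (par _ Ky); split=> [k|]; first by rewrite dE; have := hv (inr k); rewrite /=; nra.
  exists l; rewrite dE; nra.
have sum_up (s : seq 'I_m) : exists xi : 'I_m -> R, (forall k, 0 <= xi k) /\
    (forall k, k \in s -> 1 <= xi k) /\
    forall y, K y -> 0 <= \big[Rplus/R0]_(k < m) (xi k * dot (F k x) (vsub y x)).
  elim: s => [|l s [xi [xi0 [xi1 hxi]]]].
    exists (fun=> 0); split; first by move=> k; lra.
    by split=> // y _; apply: Rsum_ge0 => k; lra.
  have [nu [nu0 hnu]] := one l.
  (* The indicator of [l] supplies the coefficient 1 of [F l] in [hnu]. *)
  pose e (k : 'I_m) : R := if k == l then 1 else 0.
  have e0 k : 0 <= e k by rewrite /e; case: ifP => _; lra.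
  have el : e l = 1 by rewrite /e eqxx.
  have en k : k != l -> e k = 0 by rewrite /e => /negbTE ->.
  clearbody e; exists (fun k => xi k + (nu k + e k)).
  split; first by move=> k; have := xi0 k; have := nu0 k; have := e0 k; lra.
  split.
    move=> k; rewrite inE => /orP [/eqP -> | /xi1].
      by rewrite el; have := xi0 l; have := nu0 l; lra.
    by have := nu0 k; have := e0 k; lra.
  move=> y Ky.
  have -> : \big[Rplus/R0]_(k < m) ((xi k + (nu k + e k)) * dot (F k x) (vsub y x))
     = \big[Rplus/R0]_(k < m) (xi k * dot (F k x) (vsub y x))
       + (\big[Rplus/R0]_(k < m) (nu k * dot (F k x) (vsub y x))
       + \big[Rplus/R0]_(k < m) (e k * dot (F k x) (vsub y x))).
    by rewrite -!big_split /=; apply: eq_bigr => k _; ring.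
  rewrite [X in _ + (_ + X)](bigD1 l) //= el [X in _ + (_ + (_ + X))]big1; last first.
    by move=> k /en ->; exact: Rmult_0_l.
  have := hxi y Ky; have := hnu y Ky; rewrite -[R0]/0 Rmult_1_l Rplus_0_r.
  set A := bigop.body _ _ _; set B := bigop.body _ _ _; lra.
have [xi [_ [xi1 hxi]]] := sum_up (index_enum 'I_m).
exists xi; split; first by move=> l; have := xi1 l (mem_index_enum l); lra.
by split=> // y Ky; rewrite dot_weighted; exact: hxi.
Qed.

End Scalarization.

(** * Conclusion: a bounded component is everything *)

Lemma vconnected_of_bounded_component (n m : nat) (K : vset n) (F : 'I_m -> vec n -> vec n) x :
  vclosed K -> vconvex K -> (forall l, continuous_on K (F l)) ->
  (forall l, monotone_on K (F l)) -> vpolyhedral K ->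
  Sol F K x -> vbounded (vcomponent (Sol F K) x) -> vconnected (Sol F K).
Proof.
move=> clK cK cF mF polK Sx [M bM].
have [xi [xi0 hxi]] := pareto_weighted_solution n m F K x polK Sx.
apply: (star_connected n _ x) => y Sy.
suff : vcomponent (Sol F K) x y by [].
have [eta [eta0 heta]] := pareto_weighted_solution n m F K y polK Sy.
pose W z := weighted n m F z.
have mW (z : 'I_m -> R) : (forall l, 0 < z l) -> monotone_on K (W z).
  by move=> z0; apply: weighted_monotone => // l; exact: Rlt_le.
have cW (z : 'I_m -> R) : weakly_continuous_on K (W z).
  by apply: weighted_weakly_continuous => l; exact: continuous_weakly.
have mixE s : mix n (W xi) (W eta) s = W (fun l => (1 - s) * xi l + s * eta l).
  apply: functional_extensionality => u; apply: functional_extensionality => i.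
  by rewrite /mix /vlin /W /weighted -Rsum_lin; apply: eq_bigr => l _; ring.
have W0 : mix n (W xi) (W eta) 0 = W xi.
  by rewrite mixE; congr W; apply: functional_extensionality => l; ring.
have W1 : mix n (W xi) (W eta) 1 = W eta.
  by rewrite mixE; congr W; apply: functional_extensionality => l; ring.
apply: (solutions_in_component n (W xi) (W eta) K clK cK (mW _ xi0) (mW _ eta0)
          (cW xi) (cW eta) (Sol F K) x M _ _ bM).
(* Mixed weights remain positive, so every solution along the homotopy is Pareto. *)
- move=> s u hs; rewrite mixE => Su.
  apply: (weighted_solution_pareto n m F K (fun l => (1 - s) * xi l + s * eta l)).
    move=> l; have := convex_lt s (- xi l) (- eta l) 0 hs.
    by have := xi0 l; have := eta0 l; lra.
  exact: minty_stampacchia.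
- by rewrite W0; apply: stampacchia_minty => //; exact: mW.
- by rewrite W1; apply: stampacchia_minty => //; exact: mW.
Qed.

Theorem theorem5 (n m : nat) (K : vset n) (F : 'I_m -> vec n -> vec n) :
  (exists x, K x) -> vclosed K -> vconvex K ->
  (forall l, continuous_on K (F l)) ->
  (forall l, monotone_on K (F l)) ->
  vpolyhedral K ->
  ((~ vconnected (Sol F K)) ->
     forall x, Sol F K x -> ~ vbounded (vcomponent (Sol F K) x)) /\
  (vbounded (Sol F K) -> (exists x, Sol F K x) -> vconnected (Sol F K)).
Proof.
move=> _ clK cK cF mF polK.
have key x : Sol F K x -> vbounded (vcomponent (Sol F K) x) -> vconnected (Sol F K).
  exact: vconnected_of_bounded_component.
split=> [nc x Sx bC|[M bM] [x Sx]]; first exact/nc/(key x).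
by apply: (key x) => //; exists M => y /component_sub /bM.
Qed.
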